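(* If $\nu>-1$, then the real entire functions $$\lambda_\nu^{\mathbf{\Phi}}(z)=\sum_{n\ge0}\frac{1}{\Gamma(\nu+n+1)\Gamma(\nu+2n+2)}\frac{z^n}{n!}\quad\text{and}\quad \lambda_\nu^{\mathbf{\Pi}}(z)=\sum_{n\ge0}\frac{1}{\Gamma(\nu+n+1)\Gamma(\nu+2n+1)}\frac{z^n}{n!}$$ have no Fourier critical points (on $\mathbb{R}$).
   Context: Let $f$ be a real entire function considered on an open interval $(a,b)\subset\mathbb{R}$ (here the whole real line). Let $l\in\mathbb{N}=\{1,2,\dots\}$ and suppose $c\in(a,b)$ is a zero of $f^{(l)}$ of multiplicity $m\in\mathbb{N}$, i.e. $f^{(l)}(c)=\dots=f^{(l+m-1)}(c)=0$ and $f^{(l+m)}(c)\ne0$. Put $k=0$ if $f^{(l-1)}(c)=0$; otherwise put $$k=\begin{cases} m/2, & m \text{ even},\\ (m+1)/2, & m\text{ odd and } f^{(l-1)}(c)f^{(l+m)}(c)>0,\\ (m-1)/2, & m\text{ odd and } f^{(l-1)}(c)f^{(l+m)}(c)<0.\end{cases}$$ Then $f^{(l)}$ is said to have $k$ critical zeros and $m-k$ noncritical zeros at $x=c$. A point of $(a,b)$ is a Fourier critical point of $f$ if some derivative $f^{(l)}$, $l\ge1$, has a critical zero at that point (i.e. $k\ge1$ for some $l$). *)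

(* Defs.v *)
From Stdlib Require Import Reals Arith.
From Coquelicot Require Import Coquelicot.
Open Scope R_scope.

(* Euler's integral; only meaningful for 0 < x, where it converges. *)
Definition Gamma (x : R) : R :=
  RInt_gen (fun t => Rpower t (x - 1) * exp (- t))
           (at_right 0) (Rbar_locally p_infty).

Definition lambda_Phi (nu x : R) : R :=
  PSeries (fun n =>
    1 / (Gamma (nu + INR n + 1) * Gamma (nu + 2 * INR n + 2)) / INR (fact n)) x.

Definition lambda_Pi (nu x : R) : R :=
  PSeries (fun n =>
    1 / (Gamma (nu + INR n + 1) * Gamma (nu + 2 * INR n + 1)) / INR (fact n)) x.

(* A real entire function is represented by its restriction f to the real line:
   f is the sum of a power series with real coefficients that converges in the
   whole complex plane. *)
Definition real_entire (f : R -> R) : Prop :=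
  exists a : nat -> R,
    (forall z : C, ex_pseries (V := C_NormedModule) (fun n => RtoC (a n)) z) /\
    (forall x : R, is_pseries a x (f x)).

Definition derivative_zero (f : R -> R) (l m : nat) (c : R) : Prop :=
  (1 <= m)%nat /\
  (forall j : nat, (j < m)%nat -> Derive_n f (l + j) c = 0) /\
  Derive_n f (l + m) c <> 0.

(* The number k of critical zeros of f^(l) at a zero c of f^(l) of multiplicity
   m, for l >= 1.  For m odd the product tested below is nonzero when m is the
   multiplicity, so the last branch is the case where it is negative. *)
Definition critical_zeros (f : R -> R) (l m : nat) (c : R) : nat :=
  if Req_EM_T (Derive_n f (l - 1) c) 0 then 0%nat
  else if Nat.even m then (m / 2)%nat
  else if Rlt_dec 0 (Derive_n f (l - 1) c * Derive_n f (l + m) c)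
       then ((m + 1) / 2)%nat
       else ((m - 1) / 2)%nat.

Definition Fourier_critical_point (f : R -> R) (c : R) : Prop :=
  exists l m : nat,
    (1 <= l)%nat /\ derivative_zero f l m c /\ (1 <= critical_zeros f l m c)%nat.

(* Main.v *)
From mathcomp Require all_boot all_order all_algebra complex Rstruct ring.
Require Import Defs.
From Stdlib Require Import Reals Arith Lra Lia List FunctionalExtensionality.
From Coquelicot Require Import Coquelicot.
Open Scope R_scope.

(** Write (a)_n = a (a+1) ... (a+n-1).  Since Gamma (a + n) = Gamma a * (a)_n,
    every derivative of either function is a positive multiple of a series

      F(x) = sum_n x^n / (n! (a)_n (b)_(2n)),     a, b > 0,

    because differentiation replaces (a, b) by (a + 1, b + 2) up to a constant.
    At a critical zero c of f^(l), the function g = f^(l-1) satisfies g(c) <> 0,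
    g'(c) = 0 and g(c) g''(c) >= 0: the zero of g' is either multiple, so that
    g''(c) = 0, or simple with g(c) g''(c) > 0.  So it is enough to prove that
    g'(c) = 0 and g(c) <> 0 imply g(c) g''(c) < 0 for g = F
    ([hyp_sign_change]).

    This is a strict Laguerre inequality, expected because F only has negative
    zeros.  The strict sign would be lost in a limit of polynomials, so a
    quantitative form that survives limits is used.  If p(x) is a product of
    factors 1 + t_i x with t_i >= 0, then

      p(x)^2 (p'(0)^2 - p''(0)) <= (1 + p'(0) |x|)^2 (p'(x)^2 - p(x) p''(x));

    here p'(0) = sum t_i and p'(0)^2 - p''(0) = sum t_i^2
    ([lin_prod_laguerre]).  For F the factor F'(0)^2 - F''(0) is positive, which
    makes the limiting inequality strict wherever F is nonzero.

    It remains to approximate F by such products.  If p is one, so is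
    p + x p' / al for al > 0: at a root z of it with p(z) <> 0, the identity
    z / (1 + t z) = (z + t |z|^2) / |1 + t z|^2 yields
    al + A |z|^2 + B z = 0 with A, B >= 0, so z is a negative real
    ([euler_step]).  On coefficients this step multiplies c_n by 1 + n / al.
    Start from (1 + x / m^4)^m and take al = a + j and al = (b + j) / 2 for
    j < m.  The products of the multipliers are (a + m)_n / (a)_n and
    (b + m)_(2n) / (b)_(2n), and as m grows the n-th coefficient tends to that
    of F while staying below ((a + 2) (b + 3)^2)^n times it
    ([approx_coef_lim], [approx_coef_bound]).  Dominated convergence of series
    ([Tannery]) carries the inequality over to F. *)

(** * Polynomials with negative zeros and the Euler operator *)

Fixpoint lin_prod (l : list R) (x : R) : R :=
  match l with nil => 1 | (t :: l)%list => (1 + t * x) * lin_prod l x end.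

Fixpoint lin_prod' (l : list R) (x : R) : R :=
  match l with
  | nil => 0
  | (t :: l)%list => t * lin_prod l x + (1 + t * x) * lin_prod' l x
  end.

Module RootsOfLinearProducts.
Import all_boot all_order all_algebra complex Rstruct ring.
Import Order.TTheory GRing.Theory Num.Theory.
Local Open Scope ring_scope.
Set Implicit Arguments.
Unset Strict Implicit.

Definition lin_poly (F : fieldType) (s : seq F) : {poly F} :=
  \prod_(t <- s) (1 + t *: 'X).

Lemma lin_poly_cons (F : fieldType) (t : F) s :
  lin_poly (t :: s) = (1 + t *: 'X) * lin_poly s.
Proof. by rewrite /lin_poly big_cons. Qed.

Lemma lin_poly_at0 (F : fieldType) (s : seq F) : (lin_poly s).[0] = 1.
Proof.
elim: s => [|t s IH]; first by rewrite /lin_poly big_nil hornerC.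
by rewrite lin_poly_cons hornerM IH !hornerE.
Qed.

(** Each summand of the logarithmic derivative times z is t z / (1 + t z).
    Multiplying numerator and denominator by the conjugate of 1 + t z turns it
    into (t^2 |z|^2 + t z) / |1 + t z|^2, a combination of |z|^2 and z with
    nonnegative coefficients. *)
Lemma log_deriv_lin_poly (C : numClosedFieldType) (s : seq C) (z : C) :
  all (fun t => 0 <= t) s -> (lin_poly s).[z] != 0 ->
  exists A B : C, [/\ 0 <= A, 0 <= B &
    z * (lin_poly s)^`().[z] = (lin_poly s).[z] * (`|z| ^+ 2 * A + z * B)].
Proof.
elim: s => [|t s IH] /=.
  exists 0, 0; split=> //.
  by rewrite /lin_poly big_nil derivC horner0 !mulr0 addr0 mulr0.
move=> /andP[t0 s0].
rewrite lin_poly_cons hornerM !hornerE mulf_eq0 negb_or => /andP[nz nzs].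
have [A [B [A0 B0 E]]] := IH s0 nzs.
set u := 1 + t * z in nz *.
have N : 0 < `|u| ^+ 2 by rewrite exprn_gt0 // normr_gt0.
exists (t ^+ 2 / `|u| ^+ 2 + A), (t / `|u| ^+ 2 + B); split.
- by rewrite addr_ge0 // divr_ge0 ?exprn_ge0 // ltW.
- by rewrite addr_ge0 // divr_ge0 // ltW.
have cu : u^* = 1 + t * z^* by rewrite /u rmorphD rmorphM rmorph1 /= (geC0_conj t0).
rewrite derivM !hornerE derivD derivZ derivX derivC !hornerE -/u.
rewrite mulrDr mulrCA [z * (u * _)]mulrCA E.
have nzc : u^* != 0 by rewrite conjC_eq0.
rewrite !normCK cu in nzc *.
rewrite /u in nz *.
by field; rewrite nz nzc.
Qed.

(** Either z is already a root -1/t of the product, or dividing by the product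
    leaves al + |z|^2 A + z B = 0 with A, B >= 0.  As al > 0 this forces B > 0
    and solves z as a negative real; the relation z < 0 in a closed field
    includes that z is real. *)
Lemma euler_step_root (C : numClosedFieldType) (s : seq C) (al z : C) :
  all (fun t => 0 <= t) s -> 0 < al ->
  (lin_poly s + al^-1 *: ('X * (lin_poly s)^`())).[z] = 0 -> z < 0.
Proof.
move=> s0 al0; have [pz0 _|pz] := eqVneq (lin_poly s).[z] 0.
  elim: s s0 pz0 => [|t s IH] /=.
    by rewrite /lin_poly big_nil hornerC => _ /eqP; rewrite oner_eq0.
  move=> /andP[t0 s0]; rewrite lin_poly_cons hornerM => /eqP.
  rewrite mulf_eq0 => /orP[]; last by move/eqP; exact: IH.
  rewrite !hornerE addrC addr_eq0 => /eqP tz.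
  have tn0 : t != 0.
    by apply/eqP=> t00; move: tz; rewrite t00 mul0r => /eqP; rewrite eq_sym oppr_eq0 oner_eq0.
  have tp : 0 < t by rewrite lt_def tn0.
  by rewrite -(pmulr_rlt0 _ tp) tz oppr_lt0 ltr01.
have [A [B [A0 B0 E]]] := log_deriv_lin_poly s0 pz.
rewrite hornerD hornerZ hornerM hornerX E => q0.
have {}q0 : (lin_poly s).[z] * (al + (`|z| ^+ 2 * A + z * B)) = 0.
  rewrite -[RHS](mulr0 al) -q0; field; exact: lt0r_neq0.
move/eqP: q0; rewrite mulf_eq0 (negPf pz) /= addrA addr_eq0 => /eqP q0.
have pos : 0 < al + `|z| ^+ 2 * A by rewrite ltr_wpDr // mulr_ge0 // exprn_ge0.
have zB : z * B < 0 by rewrite -oppr_gt0 -q0.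
have Bp : 0 < B.
  by rewrite lt_def B0 andbT; apply: contraTneq zB => ->; rewrite mulr0 ltxx.
by rewrite -(pmulr_llt0 _ Bp).
Qed.

(** All roots being negative, the polynomial splits into factors 1 + s X with
    s = -1/z > 0; the constant term is 1 on both sides, so no scalar is left
    over.  Working over the closed field makes multiple roots harmless. *)
Lemma euler_step (C : numClosedFieldType) (s : seq C) (al : C) :
  all (fun t => 0 <= t) s -> 0 < al ->
  exists2 s', all (fun t => 0 <= t) s' &
    lin_poly s + al^-1 *: ('X * (lin_poly s)^`()) = lin_poly s'.
Proof.
move=> s0 al0; set q := (_ + _).
have q1 : q.[0] = 1.
  by rewrite hornerD hornerZ hornerM hornerX lin_poly_at0 mul0r mulr0 addr0.
have [r Er] := closed_field_poly_normal q.
have r0 : all (fun z => z < 0) r.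
  apply/allP => z zr; apply: (euler_step_root s0 al0).
  apply/eqP; rewrite -/(root _ _) -/q Er rootZ.
    by rewrite root_prod_XsubC.
  apply/negP => /eqP l0; move: q1; rewrite Er l0 scale0r horner0 => /eqP.
  by rewrite eq_sym oner_eq0.
exists [seq - z^-1 | z <- r].
  by apply/allP => t /mapP[z zr ->]; rewrite oppr_ge0 invr_le0 ltW // (allP r0).
have [c Ec] : exists c, \prod_(z <- r) ('X - z%:P) = c *: lin_poly [seq - z^-1 | z <- r].
  elim: r r0 {Er} => [|z r IH] /=.
    by move=> _; exists 1; rewrite /lin_poly !big_nil scale1r.
  move=> /andP[z0 /IH[c Ec]]; exists (- z * c).
  rewrite big_cons Ec lin_poly_cons.
  have -> : 'X - z%:P = (- z) *: (1 + (- z^-1) *: 'X).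
    rewrite scalerDr scalerA mulrNN divff ?scale1r ?ltr0_neq0 //.
    by rewrite addrC scaleNr -mul_polyC mulr1.
  by rewrite -scalerAl -scalerAr scalerA.
move: q1; rewrite Er Ec scalerA hornerZ lin_poly_at0 mulr1 => ->.
by rewrite scale1r.
Qed.

Notation inj := (real_complex R).

Lemma inj_lin_prod (l : seq R) (x : R) :
  (lin_poly (map inj l)).[inj x] = inj (lin_prod l x).
Proof.
elim: l => [|t l IH] /=; first by rewrite /lin_poly big_nil hornerC.
rewrite lin_poly_cons hornerM IH hornerD hornerC hornerZ hornerX.
rewrite RmultE RplusE RmultE R1E. by rewrite rmorphM rmorphD rmorphM rmorph1.
Qed.

Lemma inj_lin_prod' (l : seq R) (x : R) :
  (lin_poly (map inj l))^`().[inj x] = inj (lin_prod' l x).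
Proof.
elim: l => [|t l IH] /=; first by rewrite /lin_poly big_nil derivC horner0.
rewrite lin_poly_cons derivM derivD derivZ derivX derivC !hornerD !hornerM.
rewrite IH inj_lin_prod !hornerD hornerZ !hornerC hornerZ hornerX.
rewrite add0r mulr1 ?(RplusE,RmultE,R1E). by rewrite !(rmorphD,rmorphM,rmorph1).
Qed.

(** The splitting takes place over the complex numbers, but nonnegative complex
    numbers are real, so the new parameters descend to the reals. *)
Lemma euler_step_lin_prod (l : list R) (al : R) :
  Rlt R0 al -> List.Forall (Rle R0) l ->
  exists2 l', List.Forall (Rle R0) l' &
    forall x, Rplus (lin_prod l x) (Rmult (Rdiv x al) (lin_prod' l x)) = lin_prod l' x.
Proof.
move=> /RltP al0 l0.
have s0 : all (fun t => 0 <= t) (map inj l).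
  elim: l0 => //= t {}l /RleP t0 _ ->; by rewrite andbT lecR.
have a0 : 0 < inj al by rewrite ltcR.
have [s' s'0 E] := euler_step s0 a0.
have [l' l'0 El'] : exists2 l' : list R, List.Forall (Rle R0) l' & s' = map inj l'.
  (* the order on complex numbers only compares equal imaginary parts *)
  elim: s' s'0 {E} => [|[a b] s' IH] /=; first by exists nil; first exact: Forall_nil.
  move=> /andP[]; rewrite lecE /= => /andP[/eqP -> a0' /IH[l' l'0 ->]].
  exists (a :: l') => //; apply: Forall_cons => //; exact/RleP.
exists l' => // x.
have := congr1 (fun p => p.[inj x]) E.
rewrite hornerD hornerZ hornerM hornerX El' !inj_lin_prod inj_lin_prod'.
rewrite RplusE RmultE RdivE => H; apply: (fmorph_inj inj).
rewrite -[RHS]H.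
by rewrite !(rmorphD,rmorphM) fmorphV mulrA [_ * inj x]mulrC.
Qed.

End RootsOfLinearProducts.

(** * Euler's integral for the Gamma function *)

(** For a nonnegative integrand the integrals over [a, b] increase with the
    interval, so their supremum is the improper integral.  The lower bound by
    the integral over [1, 2] gives positivity of Gamma. *)
Lemma is_RInt_gen_nonneg_bounded (g : R -> R) (K : R) :
  (forall t, 0 < t -> 0 <= g t) ->
  (forall t, 0 < t -> continuous g t) ->
  (forall a b, 0 < a <= b -> RInt g a b <= K) ->
  exists l, is_RInt_gen g (at_right 0) (Rbar_locally p_infty) l /\ RInt g 1 2 <= l.
Proof.
  intros g0 gc gK.
  assert (ex : forall a b, 0 < a -> 0 < b -> ex_RInt g a b).
  { intros a b a0 b0. apply (ex_RInt_continuous (V := R_CompleteNormedModule)).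
    intros z Hz. apply gc. apply Rlt_le_trans with (2 := proj1 Hz).
    now apply Rmin_glb_lt. }
  assert (mono : forall a' a b b', 0 < a' <= a -> a <= b -> b <= b' ->
            RInt g a b <= RInt g a' b').
  { intros a' a b b' [? ?] ? ?.
    rewrite <- (RInt_Chasles g a' a b') by (apply ex; lra).
    rewrite <- (RInt_Chasles g a b b') by (apply ex; lra).
    assert (0 <= RInt g a' a) by
      (apply RInt_ge_0; [lra | apply ex; lra | intros; apply g0; lra]).
    assert (0 <= RInt g b b') by
      (apply RInt_ge_0; [lra | apply ex; lra | intros; apply g0; lra]).
    unfold plus; simpl; lra. }
  destruct (completeness (fun v => exists a b, 0 < a <= b /\ v = RInt g a b))
    as [l [ub lst]].
  { exists K. intros v (a & b & ab & ->). now apply gK. }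
  { exists (RInt g 1 2), 1, 2. split; [lra | reflexivity]. }
  exists l. split; [| apply ub; exists 1, 2; split; [lra | reflexivity]].
  apply filterlimi_locally. intros eps.
  assert (Hnub : exists a b, 0 < a <= b /\ l - eps < RInt g a b).
  { apply Classical_Prop.NNPP. intros H.
    assert (l <= l - eps).
    { apply lst. intros v (a & b & ab & ->). apply Rnot_lt_le. intros H'.
      apply H. now exists a, b. }
    destruct eps as [e e0]; simpl in *; lra. }
  destruct Hnub as (a & b & ab & Hl).
  apply Filter_prod with (fun x => 0 < x < a) (fun y => b < y).
  - exists (mkposreal a (proj1 ab)). intros y Hy y0. split; [exact y0|].
    change (Rabs (y - 0) < a) in Hy. rewrite Rminus_0_r in Hy.
    apply Rle_lt_trans with (2 := Hy), Rle_abs.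
  - exists b. auto.
  - intros x y Hx Hy; simpl. exists (RInt g x y). split.
    + apply (RInt_correct (V := R_CompleteNormedModule)). apply ex; lra.
    + change (Rabs (RInt g x y - l) < eps).
      assert (RInt g a b <= RInt g x y) by (apply mono; lra).
      assert (RInt g x y <= l) by (apply ub; exists x, y; split; [lra | reflexivity]).
      apply Rabs_def1; destruct eps; simpl in *; lra.
Qed.

Definition gamma_integrand (x t : R) : R := Rpower t (x - 1) * exp (- t).

Lemma gamma_integrand_pos (x t : R) : 0 < gamma_integrand x t.
Proof. apply Rmult_lt_0_compat; apply exp_pos. Qed.

Lemma is_derive_Rpower (y t : R) :
  0 < t -> is_derive (fun t => Rpower t y) t (y * Rpower t (y - 1)).
Proof. intros t0. apply is_derive_Reals. now apply derivable_pt_lim_power. Qed.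

Lemma continuous_gamma_integrand (x t : R) :
  0 < t -> continuous (gamma_integrand x) t.
Proof.
  intros t0. unfold gamma_integrand. apply (continuous_mult (K := R_AbsRing)).
  - apply (ex_derive_continuous (K := R_AbsRing) (V := R_NormedModule)).
    eexists. now apply is_derive_Rpower.
  - apply (ex_derive_continuous (K := R_AbsRing) (V := R_NormedModule)).
    auto_derive. auto.
Qed.

Lemma exp_le (x y : R) : x <= y -> exp x <= exp y.
Proof. intros [H | ->]; [left; now apply exp_increasing | apply Rle_refl]. Qed.

(** From ln u <= u - 1 at u = t / (2 s), one gets s ln t <= t / 2 + s ln (2 s);
    the scale 2 s is chosen to make the slope 1/2. *)
Lemma Rpower_le_exp_half (y : R) :
  exists c, 0 < c /\ forall t, 1 <= t -> Rpower t y <= c * exp (t / 2).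
Proof.
  set (s := Rabs y + 1). assert (s0 : 0 < s) by (unfold s; pose proof (Rabs_pos y); lra).
  exists (exp (s * ln (2 * s))). split; [apply exp_pos|]. intros t t1.
  unfold Rpower. rewrite <- exp_plus.
  assert (L0 : 0 <= ln t) by (rewrite <- ln_1; apply ln_le; lra).
  assert (L : ln t <= t / (2 * s) + ln (2 * s)).
  { replace (ln t) with (ln (t / (2 * s)) + ln (2 * s)).
    2:{ rewrite <- ln_mult; [f_equal; field; lra | apply Rdiv_lt_0_compat; lra | lra]. }
    assert (0 < t / (2 * s)) by (apply Rdiv_lt_0_compat; lra).
    pose proof (exp_ineq1_le (ln (t / (2 * s)))) as E.
    rewrite exp_ln in E by lra. lra. }
  assert (y * ln t <= s * ln t).
  { apply Rmult_le_compat_r; [lra|]. unfold s. pose proof (Rle_abs y). lra. }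
  assert (s * ln t <= s * (t / (2 * s) + ln (2 * s))) by (apply Rmult_le_compat_l; lra).
  replace (s * (t / (2 * s) + ln (2 * s))) with (s * ln (2 * s) + t / 2) in H0 by (field; lra).
  apply exp_le. lra.
Qed.

(** Below 1 the integrand is at most t^(x-1), with integral at most 1/x; above 1
    it is at most c exp (-t/2). *)
Lemma RInt_gamma_integrand_bounded (x : R) :
  0 < x -> exists K, forall a b, 0 < a <= b -> RInt (gamma_integrand x) a b <= K.
Proof.
  intros x0. destruct (Rpower_le_exp_half (x - 1)) as (c & c0 & Hc).
  exists (/ x + 2 * c).
  assert (ex : forall a b, 0 < a -> 0 < b -> ex_RInt (gamma_integrand x) a b).
  { intros a b a0 b0. apply (ex_RInt_continuous (V := R_CompleteNormedModule)).
    intros z Hz. apply continuous_gamma_integrand. apply Rlt_le_trans with (2 := proj1 Hz).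
    now apply Rmin_glb_lt. }
  assert (B1 : forall a b, 0 < a <= b -> b <= 1 -> RInt (gamma_integrand x) a b <= / x).
  { intros a b ab b1.
    assert (I : is_RInt (fun t => Rpower t (x - 1)) a b
                 (minus (Rpower b x / x) (Rpower a x / x))).
    { apply (is_RInt_derive (fun t => Rpower t x / x)).
      - intros t Ht. rewrite Rmin_left, Rmax_right in Ht by lra.
        apply (is_derive_ext (fun t => scal (/ x) (Rpower t x))).
        { intros u. unfold scal; simpl; unfold mult; simpl. field. lra. }
        replace (Rpower t (x - 1)) with (scal (/ x) (x * Rpower t (x - 1))).
        2:{ unfold scal; simpl; unfold mult; simpl. field. lra. }
        apply is_derive_scal, is_derive_Rpower. lra.
      - intros t Ht. rewrite Rmin_left, Rmax_right in Ht by lra.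
        apply (ex_derive_continuous (K := R_AbsRing) (V := R_NormedModule)).
        eexists. apply is_derive_Rpower. lra. }
    apply Rle_trans with (minus (Rpower b x / x) (Rpower a x / x)).
    - apply (is_RInt_le (gamma_integrand x) (fun t => Rpower t (x - 1)) a b); [lra | | exact I |].
      + apply (RInt_correct (V := R_CompleteNormedModule)). apply ex; lra.
      + intros t Ht. unfold gamma_integrand.
        rewrite <- (Rmult_1_r (Rpower t (x - 1))) at 2.
        apply Rmult_le_compat_l; [left; apply exp_pos|].
        rewrite <- exp_0. apply exp_le. lra.
    - unfold minus, plus, opp; simpl.
      assert (0 < Rpower a x / x) by (apply Rdiv_lt_0_compat; [apply exp_pos | lra]).
      assert (Rpower b x <= 1).
      { rewrite <- exp_0. unfold Rpower. apply exp_le.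
        assert (ln b <= 0) by (rewrite <- ln_1; apply ln_le; lra). nra. }
      assert (Rpower b x / x <= 1 / x)
        by (apply Rmult_le_compat_r; [left; apply Rinv_0_lt_compat; lra | lra]).
      lra. }
  assert (B2 : forall a b, 1 <= a <= b -> RInt (gamma_integrand x) a b <= 2 * c).
  { intros a b ab.
    assert (I : is_RInt (fun t => c * exp (- t / 2)) a b
                 (minus (- 2 * c * exp (- b / 2)) (- 2 * c * exp (- a / 2)))).
    { apply (is_RInt_derive (fun t => - 2 * c * exp (- t / 2))).
      - intros t Ht. auto_derive; [auto|]. unfold Rdiv. lra.
      - intros t Ht.
        apply (ex_derive_continuous (K := R_AbsRing) (V := R_NormedModule)).
        auto_derive. auto. }
    apply Rle_trans with (minus (- 2 * c * exp (- b / 2)) (- 2 * c * exp (- a / 2))).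
    - apply (is_RInt_le (gamma_integrand x) (fun t => c * exp (- t / 2)) a b); [lra | | exact I |].
      + apply (RInt_correct (V := R_CompleteNormedModule)). apply ex; lra.
      + intros t Ht. unfold gamma_integrand.
        replace (c * exp (- t / 2)) with (c * exp (t / 2) * exp (- t)).
        2:{ rewrite Rmult_assoc, <- exp_plus. do 2 f_equal. field. }
        apply Rmult_le_compat_r; [left; apply exp_pos|]. apply Hc. lra.
    - unfold minus, plus, opp; simpl.
      assert (0 < exp (- b / 2)) by apply exp_pos.
      assert (exp (- a / 2) <= 1) by (rewrite <- exp_0; apply exp_le; lra). nra. }
  assert (0 < / x) by (apply Rinv_0_lt_compat; lra).
  intros a b ab. destruct (Rle_dec b 1) as [b1|b1].
  { specialize (B1 a b ab b1). lra. }
  destruct (Rle_dec 1 a) as [a1|a1].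
  { assert (B := B2 a b ltac:(lra)). lra. }
  rewrite <- (RInt_Chasles (gamma_integrand x) a 1 b) by (apply ex; lra).
  assert (H1 := B1 a 1 ltac:(lra) ltac:(lra)). assert (H2 := B2 1 b ltac:(lra)).
  unfold plus; simpl. lra.
Qed.

Lemma is_RInt_gen_Gamma (x : R) :
  0 < x ->
  is_RInt_gen (gamma_integrand x) (at_right 0) (Rbar_locally p_infty) (Gamma x) /\
  0 < Gamma x.
Proof.
  intros x0. destruct (RInt_gamma_integrand_bounded x x0) as [K HK].
  destruct (is_RInt_gen_nonneg_bounded (gamma_integrand x) K) as (l & Hl & l1).
  - intros t _. left. apply gamma_integrand_pos.
  - intros t. apply continuous_gamma_integrand.
  - exact HK.
  - replace (Gamma x) with l.
    + split; [exact Hl|]. apply Rlt_le_trans with (2 := l1).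
      apply RInt_gt_0; [lra | intros; apply gamma_integrand_pos |].
      intros t Ht. apply continuous_gamma_integrand. lra.
    + symmetry. unfold Gamma.
      exact (is_RInt_gen_unique (V := R_CompleteNormedModule) (gamma_integrand x) l Hl).
Qed.

Lemma Rpower_exp_lim_0 (x : R) : 0 < x ->
  filterlim (fun t => Rpower t x * exp (- t)) (at_right 0) (locally 0).
Proof.
  intros x0. apply filterlim_locally. intros eps.
  exists (mkposreal (Rpower eps (/ x)) (exp_pos _)). intros t Ht t0; simpl in Ht.
  change (Rabs (t - 0) < Rpower eps (/ x)) in Ht. rewrite Rminus_0_r, Rabs_pos_eq in Ht by lra.
  change (Rabs (Rpower t x * exp (- t) - 0) < eps).
  assert (P : 0 < Rpower t x) by apply exp_pos. assert (E := exp_pos (- t)).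
  rewrite Rminus_0_r, Rabs_pos_eq by (left; now apply Rmult_lt_0_compat).
  assert (exp (- t) <= 1) by (rewrite <- exp_0; apply exp_le; lra).
  apply Rle_lt_trans with (Rpower t x); [nra|].
  replace (pos eps) with (Rpower (Rpower eps (/ x)) x).
  - unfold Rpower at 1 2. apply exp_increasing, Rmult_lt_compat_l; [exact x0|].
    now apply ln_increasing.
  - rewrite Rpower_mult, Rinv_l, Rpower_1; [reflexivity | apply cond_pos | lra].
Qed.

Lemma Rpower_exp_lim_infty (x : R) :
  filterlim (fun t => Rpower t x * exp (- t)) (Rbar_locally p_infty) (locally 0).
Proof.
  destruct (Rpower_le_exp_half x) as (c & c0 & Hc).
  apply filterlim_locally. intros eps. exists (Rmax 1 (- 2 * ln (eps / c))).
  intros t Ht.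
  assert (t1 := Rle_lt_trans _ _ _ (Rmax_l _ _) Ht).
  assert (t2 := Rle_lt_trans _ _ _ (Rmax_r _ _) Ht).
  change (Rabs (Rpower t x * exp (- t) - 0) < eps).
  assert (P : 0 < Rpower t x) by apply exp_pos. assert (E := exp_pos (- t)).
  rewrite Rminus_0_r, Rabs_pos_eq by (left; now apply Rmult_lt_0_compat).
  apply Rle_lt_trans with (c * exp (- t / 2)).
  - replace (c * exp (- t / 2)) with (c * exp (t / 2) * exp (- t)).
    2:{ rewrite Rmult_assoc, <- exp_plus. do 2 f_equal. field. }
    apply Rmult_le_compat_r; [lra|]. apply Hc. lra.
  - destruct eps as [e e0]; simpl in *.
    replace e with (c * exp (ln (e / c))).
    2:{ rewrite exp_ln; [field; lra | now apply Rdiv_lt_0_compat]. }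
    apply Rmult_lt_compat_l; [exact c0|]. apply exp_increasing. lra.
Qed.

Lemma filter_prod_positive (P : R -> Prop) :
  (forall x, 0 < x -> P x) ->
  filter_prod (at_right 0) (Rbar_locally p_infty)
    (fun ab => forall x, Rmin (fst ab) (snd ab) <= x <= Rmax (fst ab) (snd ab) -> P x).
Proof.
  intros H. apply Filter_prod with (fun x => 0 < x) (fun x => 0 < x).
  - exists (mkposreal 1 Rlt_0_1). auto.
  - exists 0. auto.
  - intros a b a0 b0 x Hx; simpl in Hx. apply H.
    apply Rlt_le_trans with (2 := proj1 Hx). now apply Rmin_glb_lt.
Qed.

(** Integration by parts: the derivative of t^x exp (-t) is the difference of
    the integrands of x Gamma x and Gamma (x + 1), and t^x exp (-t) vanishes at
    both ends. *)
Lemma Gamma_succ (x : R) : 0 < x -> Gamma (x + 1) = x * Gamma x.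
Proof.
  intros x0.
  set (f := fun t => Rpower t x * exp (- t)).
  set (f' := fun t => x * gamma_integrand x t - gamma_integrand (x + 1) t).
  assert (D : forall t, 0 < t -> is_derive f t (f' t)).
  { intros t t0. unfold f, f', gamma_integrand. replace (x + 1 - 1) with x by ring.
    assert (D2 : is_derive (fun t => exp (- t)) t (- exp (- t))) by (auto_derive; [auto | ring]).
    assert (D := is_derive_mult (fun t => Rpower t x) (fun t => exp (- t)) t _ _
              (is_derive_Rpower x t t0) D2 Rmult_comm).
    replace (x * (Rpower t (x - 1) * exp (- t)) - Rpower t x * exp (- t))
      with (x * Rpower t (x - 1) * exp (- t) + Rpower t x * - exp (- t)) by ring.
    exact D. }
  assert (H0 : is_RInt_gen (Derive f) (at_right 0) (Rbar_locally p_infty) (0 - 0)).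
  { apply is_RInt_gen_Derive.
    - apply filter_prod_positive. intros t t0. eexists. now apply D.
    - apply filter_prod_positive. intros t t0. apply (continuous_ext_loc (T := R_UniformSpace) (U := R_UniformSpace) (Derive f) f' t).
      + exists (mkposreal t t0). intros y Hy. symmetry. apply is_derive_unique, D.
        apply (Rabs_def2 (y - t)) in Hy; simpl in Hy. lra.
      + unfold f'. apply (continuous_minus (V := R_NormedModule)).
        * apply (continuous_scal_r (V := R_NormedModule) x). now apply continuous_gamma_integrand.
        * now apply continuous_gamma_integrand.
    - now apply Rpower_exp_lim_0.
    - apply Rpower_exp_lim_infty. }
  assert (H1 := proj1 (is_RInt_gen_Gamma x x0)).
  assert (H2 := proj1 (is_RInt_gen_Gamma (x + 1) ltac:(lra))).
  assert (H3 := is_RInt_gen_minus _ _ _ _ (is_RInt_gen_scal _ x _ H1) H2).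
  assert (E : 0 - 0 = minus (scal x (Gamma x)) (Gamma (x + 1))).
  { rewrite <- (is_RInt_gen_unique (V := R_CompleteNormedModule) _ _ H0).
    apply (is_RInt_gen_unique (V := R_CompleteNormedModule)).
    revert H3. apply is_RInt_gen_ext.
    generalize (filter_prod_positive (fun t => f' t = Derive f t)).
    intros F. assert (F1 := F (fun t t0 => eq_sym (is_derive_unique f t (f' t) (D t t0)))).
    revert F1. apply filter_imp. intros ab Hab t Ht. apply Hab. lra. }
  unfold minus, plus, opp, scal in E; simpl in E; unfold mult in E; simpl in E. lra.
Qed.

(** * Limits of power series under domination *)

(** Dominated convergence for series: the tails after n are bounded, uniformly
    in M, by the tail of the dominating series. *)
Lemma Tannery (v : nat -> nat -> R) (u w : nat -> R) :
  ex_series u -> (forall M n, Rabs (v M n) <= u n) ->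
  (forall n, is_lim_seq (fun M => v M n) (w n)) ->
  is_lim_seq (fun M => Series (v M)) (Series w).
Proof.
  intros Hu Hv Hw.
  assert (Hwu : forall n, Rabs (w n) <= u n).
  { intros n. apply (is_lim_seq_le (fun M => Rabs (v M n)) (fun _ => u n) (Rabs (w n)) (u n)).
    - intros M. apply Hv.
    - now apply (is_lim_seq_abs _ (w n)).
    - apply is_lim_seq_const. }
  assert (exv : forall M, ex_series (v M)) by
    (intros M; now apply (ex_series_le (V := R_CompleteNormedModule) _ u (Hv M))).
  assert (exw : ex_series w) by now apply (ex_series_le (V := R_CompleteNormedModule) _ u Hwu).
  assert (tail : forall a n, (forall k, Rabs (a k) <= u k) -> ex_series a ->
            Rabs (Series a - sum_n a n) <= Series u - sum_n u n).
  { intros a n Ha exa.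
    rewrite (Series_incr_n a (S n)), (Series_incr_n u (S n)) by (try lia; assumption).
    simpl pred. rewrite <- !sum_n_Reals.
    replace (sum_n a n + _ - sum_n a n) with (Series (fun k => a (S n + k)%nat)) by ring.
    replace (sum_n u n + _ - sum_n u n) with (Series (fun k => u (S n + k)%nat)) by ring.
    assert (exu' : ex_series (fun k => u (S n + k)%nat)) by now apply ex_series_incr_n.
    apply Rle_trans with (Series (fun k => Rabs (a (S n + k)%nat))).
    - apply Series_Rabs.
      apply (ex_series_le (V := R_CompleteNormedModule) _ (fun k => u (S n + k)%nat)); [|exact exu'].
      intros k. change (Rabs (Rabs (a (S n + k)%nat)) <= u (S n + k)%nat). rewrite Rabs_Rabsolu. apply Ha.
    - apply Series_le; [|exact exu']. intros k. split; [apply Rabs_pos | apply Ha]. }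
  apply is_lim_seq_spec. intros eps.
  assert (Hu' : is_lim_seq (sum_n u) (Series u)) by exact (Series_correct u Hu).
  apply is_lim_seq_spec in Hu'.
  destruct (Hu' (pos_div_2 (pos_div_2 eps))) as [n Hn]. specialize (Hn n (le_n n)).
  apply Rabs_def2 in Hn; simpl in Hn.
  assert (Hs : is_lim_seq (fun M => sum_n (v M) n) (sum_n w n)).
  { clear Hn. induction n as [|n IH].
    - apply (is_lim_seq_ext (fun M => v M 0%nat)); [intros; now rewrite sum_O|].
      rewrite sum_O. apply Hw.
    - apply (is_lim_seq_ext (fun M => sum_n (v M) n + v M (S n))).
      { intros; now rewrite sum_Sn. }
      rewrite sum_Sn. now apply is_lim_seq_plus'. }
  apply is_lim_seq_spec in Hs. destruct (Hs (pos_div_2 eps)) as [N HN].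
  exists N. intros M HM. specialize (HN M HM). apply Rabs_def2 in HN; simpl in HN.
  assert (T1 := tail (v M) n (Hv M) (exv M)). apply Rabs_le_between in T1.
  assert (T2 := tail w n Hwu exw). apply Rabs_le_between in T2.
  apply Rabs_def1; lra.
Qed.

Lemma ex_series_pseries_abs (a : nat -> R) (x : R) :
  CV_radius a = p_infty -> ex_series (fun n => Rabs (a n) * Rabs x ^ n).
Proof.
  intros Ha. apply (ex_series_ext (fun n => Rabs (a n * x ^ n))).
  - intros n. now rewrite Rabs_mult, RPow_abs.
  - apply CV_disk_inside. now rewrite Ha.
Qed.

Lemma PSeries_lim (c : nat -> nat -> R) (u d : nat -> R) (x : R) :
  CV_radius u = p_infty -> (forall M n, Rabs (c M n) <= u n) ->
  (forall n, is_lim_seq (fun M => c M n) (d n)) ->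
  is_lim_seq (fun M => PSeries (c M) x) (PSeries d x).
Proof.
  intros Hu Hc Hd. unfold PSeries.
  apply Tannery with (fun n => Rabs (u n) * Rabs x ^ n).
  - now apply ex_series_pseries_abs.
  - intros M n. rewrite Rabs_mult, RPow_abs. apply Rmult_le_compat_r; [apply Rabs_pos|].
    apply Rle_trans with (2 := Rle_abs _). apply Hc.
  - intros n. apply (is_lim_seq_scal_r _ (x ^ n) (d n)). apply Hd.
Qed.

(** Beyond a finite radius of convergence the terms do not tend to 0. *)
Lemma CV_radius_everywhere (a : nat -> R) :
  (forall x, ex_pseries a x) -> CV_radius a = p_infty.
Proof.
  intros H. assert (P := CV_radius_ge_0 a). destruct (CV_radius a) as [r| |] eqn:E; simpl in P.
  - exfalso. apply (CV_disk_outside a (r + 1)).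
    + rewrite E. simpl. rewrite Rabs_pos_eq; lra.
    + apply ex_series_lim_0. specialize (H (r + 1)). revert H. apply ex_series_ext.
      intros n. rewrite pow_n_pow. apply Rmult_comm.
  - reflexivity.
  - contradiction.
Qed.

Lemma CV_radius_dominated (a u : nat -> R) :
  CV_radius u = p_infty -> (forall n, Rabs (a n) <= u n) -> CV_radius a = p_infty.
Proof.
  intros Hu Ha. apply CV_radius_everywhere. intros x.
  apply (ex_series_le (V := R_CompleteNormedModule) _ (fun n => Rabs (u n) * Rabs x ^ n)).
  - intros n. change (Rabs (pow_n x n * a n) <= Rabs (u n) * Rabs x ^ n).
    rewrite pow_n_pow, Rmult_comm, Rabs_mult, RPow_abs. apply Rmult_le_compat_r; [apply Rabs_pos|].
    apply Rle_trans with (2 := Rle_abs _). apply Ha.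
  - now apply ex_series_pseries_abs.
Qed.

(** * The Laguerre inequality with an explicit gap *)

Fixpoint lin_prod'' (l : list R) (x : R) : R :=
  match l with
  | nil => 0
  | (t :: l)%list => 2 * t * lin_prod' l x + (1 + t * x) * lin_prod'' l x
  end.

Lemma is_derive_affine_mult (f : R -> R) (t x f' : R) :
  is_derive f x f' ->
  is_derive (fun x => (1 + t * x) * f x) x (t * f x + (1 + t * x) * f').
Proof.
  intros Hf. assert (D : is_derive (fun x => 1 + t * x) x t) by (auto_derive; [auto | ring]).
  exact (is_derive_mult _ _ x _ _ D Hf Rmult_comm).
Qed.

Lemma is_derive_lin_prod (l : list R) (x : R) : is_derive (lin_prod l) x (lin_prod' l x).
Proof.
  induction l as [|t l IH]; simpl.
  - apply (is_derive_const (V := R_NormedModule)).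
  - now apply is_derive_affine_mult.
Qed.

Lemma is_derive_lin_prod' (l : list R) (x : R) : is_derive (lin_prod' l) x (lin_prod'' l x).
Proof.
  induction l as [|t l IH]; simpl.
  - apply (is_derive_const (V := R_NormedModule)).
  - replace (2 * t * lin_prod' l x + (1 + t * x) * lin_prod'' l x)
      with (t * lin_prod' l x + (t * lin_prod' l x + (1 + t * x) * lin_prod'' l x)) by ring.
    apply (is_derive_plus (V := R_NormedModule) (fun x => t * lin_prod l x)).
    + apply (is_derive_scal (lin_prod l)), is_derive_lin_prod.
    + now apply is_derive_affine_mult.
Qed.

Lemma lin_prod_0 (l : list R) : lin_prod l 0 = 1.
Proof. induction l as [|t l IH]; simpl; [|rewrite IH]; ring. Qed.

(** Put L(p) = p'^2 - p p''.  For p = (1 + t x) q one computes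
    L(p) = t^2 q^2 + (1 + t x)^2 L(q).  If D^2 >= (1 + t x)^2 for all
    parameters t, an induction gives D^2 L(p) >= p^2 * (sum of the t^2).
    Every parameter is at most their sum p'(0), so D = 1 + p'(0) |x| works, and
    the sum of the squares is p'(0)^2 - p''(0).  Only values and derivatives of
    p appear, so the inequality is stable under limits. *)
Lemma lin_prod_laguerre (l : list R) (x : R) :
  List.Forall (Rle 0) l ->
  lin_prod l x ^ 2 * (lin_prod' l 0 ^ 2 - lin_prod'' l 0) <=
  (1 + lin_prod' l 0 * Rabs x) ^ 2 *
  (lin_prod' l x ^ 2 - lin_prod l x * lin_prod'' l x).
Proof.
  intros l0.
  assert (S1 : 0 <= lin_prod' l 0 /\ List.Forall (fun t => t <= lin_prod' l 0) l).
  { induction l0 as [|t l t0 l0 [IH0 IH]]; simpl; [split; [lra|constructor]|].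
    rewrite lin_prod_0. split; [lra|]. constructor; [lra|].
    revert IH. apply Forall_impl. intros s. lra. }
  destruct S1 as [s0 S1]. set (D := 1 + lin_prod' l 0 * Rabs x).
  assert (HD : List.Forall (fun t => (1 + t * x) ^ 2 <= D ^ 2) l).
  { rewrite Forall_forall in *. intros t tl. specialize (l0 t tl). specialize (S1 t tl).
    apply pow_maj_Rabs. apply Rle_trans with (1 := Rabs_triang _ _).
    rewrite Rabs_R1, Rabs_mult, (Rabs_pos_eq t) by exact l0.
    apply Rplus_le_compat_l, Rmult_le_compat_r; [apply Rabs_pos | exact S1]. }
  (* D belongs to the full list and stays fixed while the list shrinks *)
  clearbody D. clear s0 S1. induction HD as [|t l tD HD IH]; simpl; [lra|].
  inversion_clear l0. specialize (IH H0). rewrite lin_prod_0.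
  assert (A := Rmult_le_compat_l ((1 + t * x) ^ 2) _ _ (pow2_ge_0 _) IH).
  assert (B := Rmult_le_compat_l ((t * lin_prod l x) ^ 2) _ _ (pow2_ge_0 _) tD).
  ring_simplify in A. ring_simplify in B. ring_simplify. lra.
Qed.

Definition negative_rooted (c : nat -> R) : Prop :=
  exists2 l, List.Forall (Rle 0) l & forall x, is_pseries c x (lin_prod l x).

Lemma negative_rooted_entire (c : nat -> R) : negative_rooted c -> CV_radius c = p_infty.
Proof.
  intros [l _ Hl]. apply CV_radius_everywhere. intros x. exists (lin_prod l x). apply Hl.
Qed.

Lemma is_derive_PSeries_entire (c : nat -> R) (x : R) :
  CV_radius c = p_infty -> is_derive (PSeries c) x (PSeries (PS_derive c) x).
Proof. intros H. apply is_derive_PSeries. now rewrite H. Qed.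

Lemma PSeries_derive_lin_prod (c : nat -> R) (l : list R) :
  (forall x, is_pseries c x (lin_prod l x)) ->
  forall x, PSeries c x = lin_prod l x /\ PSeries (PS_derive c) x = lin_prod' l x /\
    PSeries (PS_derive (PS_derive c)) x = lin_prod'' l x.
Proof.
  intros Hl.
  assert (H0 : forall x, PSeries c x = lin_prod l x) by (intros; now apply is_pseries_unique).
  assert (HR : CV_radius c = p_infty).
  { apply CV_radius_everywhere. intros x. exists (lin_prod l x). apply Hl. }
  assert (H1 : forall x, PSeries (PS_derive c) x = lin_prod' l x).
  { intros x. rewrite <- (is_derive_unique _ _ _ (is_derive_PSeries_entire c x HR)).
    rewrite (Derive_ext _ _ x H0). apply is_derive_unique, is_derive_lin_prod. }
  intros x. split; [apply H0|]. split; [apply H1|].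
  rewrite <- CV_radius_derive in HR.
  rewrite <- (is_derive_unique _ _ _ (is_derive_PSeries_entire _ x HR)).
  rewrite (Derive_ext _ _ x H1). apply is_derive_unique, is_derive_lin_prod'.
Qed.

(** The coefficient of x p' / al at x^n is n c_n / al. *)
Lemma negative_rooted_euler (c : nat -> R) (al : R) :
  0 < al -> negative_rooted c -> negative_rooted (fun n => c n * (1 + INR n / al)).
Proof.
  intros al0 Hc. assert (HR := negative_rooted_entire c Hc). destruct Hc as [l l0 Hl].
  destruct (RootsOfLinearProducts.euler_step_lin_prod al0 l0) as [l' l'0 Hl']. exists l'; [exact l'0|].
  intros x. rewrite <- Hl'.
  assert (H1 : is_pseries (PS_derive c) x (lin_prod' l x)).
  { rewrite <- (proj1 (proj2 (PSeries_derive_lin_prod c l Hl x))).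
    apply PSeries_correct, CV_radius_inside. now rewrite CV_radius_derive, HR. }
  apply is_pseries_incr_1, (is_pseries_scal (/ al)) in H1; [|apply Rmult_comm].
  assert (H2 := is_pseries_plus _ _ _ _ _ (Hl x) H1).
  replace (lin_prod l x + x / al * lin_prod' l x)
    with (plus (lin_prod l x) (scal (/ al) (scal x (lin_prod' l x)))).
  2:{ unfold plus, scal; simpl; unfold mult; simpl. field. lra. }
  revert H2. apply is_pseries_ext. intros [|n].
  - unfold PS_plus, PS_scal, PS_incr_1, plus, scal, zero; simpl; unfold mult; simpl. field. lra.
  - unfold PS_plus, PS_scal, PS_incr_1, PS_derive, plus, scal; cbn -[INR]; unfold mult; cbn -[INR].
    field. lra.
Qed.

Definition laguerre_ineq (c : nat -> R) (x : R) : Prop :=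
  PSeries c x ^ 2 * (PSeries (PS_derive c) 0 ^ 2 - PSeries (PS_derive (PS_derive c)) 0) <=
  (1 + PSeries (PS_derive c) 0 * Rabs x) ^ 2 *
  (PSeries (PS_derive c) x ^ 2 - PSeries c x * PSeries (PS_derive (PS_derive c)) x).

Lemma negative_rooted_laguerre (c : nat -> R) (x : R) :
  negative_rooted c -> laguerre_ineq c x.
Proof.
  intros [l l0 Hl]. unfold laguerre_ineq.
  destruct (PSeries_derive_lin_prod c l Hl x) as (-> & -> & ->).
  destruct (PSeries_derive_lin_prod c l Hl 0) as (_ & -> & ->).
  now apply lin_prod_laguerre.
Qed.

Lemma PS_derive_dominated (c u : nat -> R) :
  (forall n, Rabs (c n) <= u n) -> forall n, Rabs (PS_derive c n) <= PS_derive u n.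
Proof.
  intros H n. unfold PS_derive. rewrite Rabs_mult, (Rabs_pos_eq (INR _)) by apply pos_INR.
  apply Rmult_le_compat_l; [apply pos_INR | apply H].
Qed.

Lemma PS_derive_lim (c : nat -> nat -> R) (d : nat -> R) :
  (forall n, is_lim_seq (fun M => c M n) (d n)) ->
  forall n, is_lim_seq (fun M => PS_derive (c M) n) (PS_derive d n).
Proof. intros H n. apply (is_lim_seq_scal_l _ _ (d (S n))), H. Qed.

(** Domination passes to the formal derivatives, so all the values in the
    inequality converge. *)
Lemma laguerre_ineq_lim (c : nat -> nat -> R) (u d : nat -> R) (x : R) :
  CV_radius u = p_infty -> (forall M n, Rabs (c M n) <= u n) ->
  (forall n, is_lim_seq (fun M => c M n) (d n)) ->
  (forall M, laguerre_ineq (c M) x) -> laguerre_ineq d x.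
Proof.
  intros Hu Hc Hd HL. unfold laguerre_ineq in *.
  assert (L0 := fun y => PSeries_lim _ _ _ y Hu Hc Hd).
  assert (Hu1 := Hu). rewrite <- CV_radius_derive in Hu1.
  assert (Hc1 := fun M => PS_derive_dominated _ _ (Hc M)).
  assert (Hd1 := PS_derive_lim _ _ Hd).
  assert (L1 := fun y => PSeries_lim _ _ _ y Hu1 Hc1 Hd1).
  assert (Hu2 := Hu1). rewrite <- CV_radius_derive in Hu2.
  assert (L2 := fun y => PSeries_lim _ _ _ y Hu2 (fun M => PS_derive_dominated _ _ (Hc1 M))
                   (PS_derive_lim _ _ Hd1)).
  assert (sq : forall (v : nat -> R) (l : R), is_lim_seq v l -> is_lim_seq (fun n => v n ^ 2) (l ^ 2)).
  { intros v l Hv. apply (is_lim_seq_ext (fun n => v n * v n)); [intros; ring|].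
    replace (l ^ 2) with (l * l) by ring. now apply is_lim_seq_mult'. }
  eapply (is_lim_seq_le _ _ (Finite _) (Finite _)); [exact HL| |].
  - apply is_lim_seq_mult'; [apply sq, L0|]. apply is_lim_seq_minus'; [apply sq, L1 | apply L2].
  - apply is_lim_seq_mult'; [apply sq | apply is_lim_seq_minus'; [apply sq, L1|]].
    + apply is_lim_seq_plus'; [apply is_lim_seq_const|].
      apply is_lim_seq_mult'; [apply L1 | apply is_lim_seq_const].
    + apply is_lim_seq_mult'; [apply L0 | apply L2].
Qed.

(** * Approximation by products with negative zeros *)

Fixpoint poch (a : R) (n : nat) : R :=
  match n with O => 1 | S n => poch a n * (a + INR n) end.

Lemma poch_pos (a : R) (n : nat) : 0 < a -> 0 < poch a n.
Proof.
  intros a0. induction n as [|n IH]; simpl; [lra|].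
  apply Rmult_lt_0_compat; [exact IH|]. pose proof (pos_INR n). lra.
Qed.

Lemma poch_add (a : R) (m n : nat) : poch a (m + n) = poch a m * poch (a + INR m) n.
Proof.
  induction n as [|n IH]; [rewrite Nat.add_0_r; simpl; ring|].
  rewrite Nat.add_succ_r. simpl. rewrite IH, plus_INR. ring.
Qed.

Lemma poch_succ_l (a : R) (n : nat) : poch a (S n) = a * poch (a + 1) n.
Proof. change (S n) with (1 + n)%nat. rewrite poch_add. simpl. ring. Qed.

(** Both (a)_m (a + m)_n and (a)_n (a + n)_m equal (a)_(m + n). *)
Lemma poch_shift_ratio (a : R) (m n : nat) : 0 < a ->
  poch (a + INR m) n / poch a n = poch (a + INR n) m / poch a m.
Proof.
  intros a0. assert (H := poch_add a m n). rewrite Nat.add_comm, poch_add in H.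
  assert (P1 := poch_pos a m a0). assert (P2 := poch_pos a n a0).
  apply (Rmult_eq_reg_l (poch a m * poch a n)); [|nra]. field_simplify; lra.
Qed.

Lemma poch_neg_nat (m n : nat) : (m < n)%nat -> poch (- INR m) n = 0.
Proof.
  intros H. replace n with (S m + (n - S m))%nat by lia. rewrite poch_add. simpl poch. ring.
Qed.

(** These are the coefficients of (1 + h x)^M: the product (-M)_n (-h)^n equals
    M (M - 1) ... (M - n + 1) h^n.  The induction step is Pascal's rule, that
    is, multiplication by 1 + h x. *)
Lemma negative_rooted_binomial (M : nat) (h : R) : 0 <= h ->
  negative_rooted (fun n => poch (- INR M) n * (- h) ^ n / INR (fact n)).
Proof.
  intros h0. induction M as [|M [l l0 Hl]].
  - exists nil; [constructor|]. intros x. simpl lin_prod.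
    apply (is_pseries_ext (fun n => match n with O => 1 | S _ => 0 end)).
    + intros [|n]; [simpl; field | rewrite poch_neg_nat by lia; unfold Rdiv; now rewrite !Rmult_0_l].
    + apply (filterlim_ext (fun _ => 1)); [|apply filterlim_const].
      intros n. induction n as [|n IH]; [rewrite sum_O; symmetry; apply (scal_one (V := R_NormedModule))|].
      rewrite sum_Sn, <- IH. unfold plus, scal; simpl; unfold mult; simpl. ring.
  - exists (h :: l)%list; [now constructor|]. intros x. simpl lin_prod.
    assert (H := is_pseries_plus _ _ _ _ _ (Hl x)
       (is_pseries_scal h _ _ _ (Rmult_comm _ _) (is_pseries_incr_1 _ _ _ (Hl x)))).
    replace ((1 + h * x) * lin_prod l x)
      with (plus (lin_prod l x) (scal h (scal x (lin_prod l x)))).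
    2:{ unfold plus, scal; simpl; unfold mult; simpl. ring. }
    revert H. apply is_pseries_ext. intros [|n].
    + unfold PS_plus, PS_scal, PS_incr_1, plus, scal, zero; simpl; unfold mult; simpl. field.
    + unfold PS_plus, PS_scal, PS_incr_1, plus, scal; cbn -[INR fact poch pow]; unfold mult; cbn -[INR fact poch pow].
      rewrite (poch_succ_l (- INR (S M))). replace (- INR (S M) + 1) with (- INR M) by (rewrite S_INR; ring).
      rewrite fact_simpl, mult_INR, !S_INR. cbn [poch pow].
      field. split; [apply INR_fact_neq_0 | pose proof (pos_INR n); lra].
Qed.

(** Iterating the Euler step with al = (a + j) / r for j < N multiplies the n-th
    coefficient by the product of the (a + j + r n) / (a + j). *)
Lemma negative_rooted_poch (c : nat -> R) (a r : R) (N : nat) : 0 < a -> 0 < r ->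
  negative_rooted c ->
  negative_rooted (fun n => c n * (poch (a + r * INR n) N / poch a N)).
Proof.
  intros a0 r0 Hc. induction N as [|N [l l0 Hl]].
  - destruct Hc as [l l0 Hl]. exists l; [exact l0|]. intros x.
    generalize (Hl x). apply is_pseries_ext. intros n. simpl. field.
  - assert (aN : 0 < a + INR N) by (pose proof (pos_INR N); lra).
    destruct (negative_rooted_euler _ ((a + INR N) / r) ltac:(now apply Rdiv_lt_0_compat)
               (ex_intro2 _ _ l l0 Hl)) as [l' l'0 Hl'].
    exists l'; [exact l'0|]. intros x. generalize (Hl' x). apply is_pseries_ext.
    intros n. simpl. assert (P := poch_pos a N a0). field. lra.
Qed.

(** * The hypergeometric series *)

Definition hyp_coef (a b : R) (n : nat) : R :=
  / (INR (fact n) * poch a n * poch b (2 * n)).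

Lemma hyp_coef_pos (a b : R) (n : nat) : 0 < a -> 0 < b -> 0 < hyp_coef a b n.
Proof.
  intros a0 b0. apply Rinv_0_lt_compat, Rmult_lt_0_compat; [|now apply poch_pos].
  apply Rmult_lt_0_compat; [apply INR_fact_lt_0 | now apply poch_pos].
Qed.

(** The geometric factor k^n is there because the series with it dominates the
    approximating polynomials. *)
Lemma CV_radius_hyp_coef (a b k : R) : 0 < a -> 0 < b -> 0 < k ->
  CV_radius (fun n => k ^ n * hyp_coef a b n) = p_infty.
Proof.
  intros a0 b0 k0.
  assert (P : forall n, 0 < k ^ n * hyp_coef a b n).
  { intros n. apply Rmult_lt_0_compat; [now apply pow_lt | now apply hyp_coef_pos]. }
  apply CV_radius_infinite_DAlembert.
  { intros n. apply Rgt_not_eq, P. }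
  set (C := k / (a * b * b)).
  apply (is_lim_seq_le_le (fun _ => 0) _ (fun n => C * / INR (S n))).
  - intros n. split; [apply Rabs_pos|].
    rewrite Rabs_pos_eq by (left; now apply Rdiv_lt_0_compat).
    assert (E : k ^ S n * hyp_coef a b (S n) / (k ^ n * hyp_coef a b n) =
      k * / INR (S n) * / ((a + INR n) * (b + INR (2 * n)) * (b + INR (S (2 * n))))).
    { unfold hyp_coef. replace (2 * S n)%nat with (S (S (2 * n))) by lia.
      rewrite fact_simpl, mult_INR. cbn [poch pow].
      pose proof (pos_INR n). pose proof (pos_INR (2 * n)). pose proof (pos_INR (S (2 * n))).
      assert (INR (S n) <> 0) by (apply not_0_INR; lia).
      pose proof (poch_pos a n a0). pose proof (poch_pos b (2 * n) b0).
      pose proof (pow_lt k n k0). pose proof (INR_fact_neq_0 n).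
      field. repeat split; try lra; auto. }
    rewrite E. unfold C, Rdiv. rewrite (Rmult_assoc k), (Rmult_comm (/ INR (S n))), <- Rmult_assoc.
    assert (0 < / INR (S n)) by (apply Rinv_0_lt_compat, lt_0_INR; lia).
    apply Rmult_le_compat_r; [lra|]. apply Rmult_le_compat_l; [lra|].
    apply Rinv_le_contravar; [repeat apply Rmult_lt_0_compat; assumption|].
    pose proof (pos_INR n). pose proof (pos_INR (2 * n)). pose proof (pos_INR (S (2 * n))).
    repeat apply Rmult_le_compat; nra.
  - apply is_lim_seq_const.
  - replace 0 with (C * 0) by ring. apply is_lim_seq_mult'; [apply is_lim_seq_const|].
    apply (is_lim_seq_inv (fun n => INR (S n)) p_infty); [|discriminate].
    apply (is_lim_seq_incr_1 INR). apply is_lim_seq_INR.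
Qed.

Lemma poch_scaled_lim (a s r : R) (n : nat) :
  is_lim_seq (fun M => poch (a + s * INR (S M)) n * (r / INR (S M)) ^ n) ((s * r) ^ n).
Proof.
  induction n as [|n IH].
  - apply (is_lim_seq_ext (fun _ => 1)); [intros; simpl; ring | apply is_lim_seq_const].
  - apply (is_lim_seq_ext (fun M => poch (a + s * INR (S M)) n * (r / INR (S M)) ^ n *
             (s * r + r * (a + INR n) * / INR (S M)))).
    + intros M. cbn [poch pow]. field. apply not_0_INR; lia.
    + replace ((s * r) ^ S n) with ((s * r) ^ n * (s * r + r * (a + INR n) * 0)) by (simpl; ring).
      apply is_lim_seq_mult'; [exact IH|]. apply is_lim_seq_plus'; [apply is_lim_seq_const|].
      apply is_lim_seq_mult'; [apply is_lim_seq_const|].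
      apply (is_lim_seq_inv (fun n => INR (S n)) p_infty); [|discriminate].
      apply (is_lim_seq_incr_1 INR). apply is_lim_seq_INR.
Qed.

Lemma poch_scaled_bound (a : R) (k m n : nat) : 0 < a -> (0 < m)%nat -> (n <= k * m)%nat ->
  0 <= poch (a + INR m) n * (1 / INR m) ^ n <= (a + 1 + INR k) ^ n.
Proof.
  intros a0 m0. assert (M1 : 1 <= INR m) by (apply (le_INR 1); lia).
  induction n as [|n IH]; intros Hn; [simpl; lra|].
  specialize (IH ltac:(lia)).
  replace (poch (a + INR m) (S n) * (1 / INR m) ^ S n)
    with (poch (a + INR m) n * (1 / INR m) ^ n * ((a + INR m + INR n) / INR m))
    by (cbn [poch pow]; field; lra).
  assert (N : INR n <= INR k * INR m) by (rewrite <- mult_INR; apply le_INR; lia).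
  assert (Q : 0 <= (a + INR m + INR n) / INR m <= a + 1 + INR k).
  { pose proof (pos_INR n). split.
    - apply Rmult_le_pos; [lra | left; apply Rinv_0_lt_compat; lra].
    - apply Rle_div_l; nra. }
  simpl. rewrite (Rmult_comm (a + 1 + INR k)). split; [apply Rmult_le_pos; lra|].
  apply Rmult_le_compat; lra.
Qed.

(** For n <= m each new factor is 1 - n / m, and for n > m the product vanishes
    because it contains the factor -m + m. *)
Lemma poch_neg_scaled_bound (m n : nat) : (0 < m)%nat ->
  Rabs (poch (- INR m) n * (- 1 / INR m) ^ n) <= 1.
Proof.
  intros m0. assert (M1 : 1 <= INR m) by (apply (le_INR 1); lia).
  induction n as [|n IH]; [simpl; rewrite Rmult_1_r, Rabs_R1; lra|].
  destruct (le_lt_dec n m) as [nm|mn].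
  - replace (poch (- INR m) (S n) * (- 1 / INR m) ^ S n)
      with (poch (- INR m) n * (- 1 / INR m) ^ n * (1 - INR n / INR m))
      by (cbn [poch pow]; field; lra).
    assert (N := le_INR n m nm). pose proof (pos_INR n).
    assert (0 <= INR n / INR m <= 1).
    { split; [apply Rmult_le_pos; [lra | left; apply Rinv_0_lt_compat; lra]|].
      apply Rle_div_l; nra. }
    rewrite Rabs_mult, (Rabs_pos_eq (1 - _)) by lra.
    pose proof (Rabs_pos (poch (- INR m) n * (- 1 / INR m) ^ n)). nra.
  - rewrite poch_neg_nat by lia. rewrite Rmult_0_l, Rabs_R0. lra.
Qed.

(** Each factor 1 / m compensates the growth of one factor of a rising factorial,
    so the three products tend to 1.  Together they amount to the substitution of
    x / m^4 for x. *)
Definition approx_coef (a b : R) (m n : nat) : R :=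
  poch (- INR m) n * (- 1 / INR m) ^ n *
  (poch (a + INR m) n * (1 / INR m) ^ n) *
  (poch (b + INR m) (2 * n) * (1 / INR m) ^ (2 * n)) * hyp_coef a b n.

Lemma negative_rooted_approx (a b : R) (m : nat) : 0 < a -> 0 < b -> (0 < m)%nat ->
  negative_rooted (approx_coef a b m).
Proof.
  intros a0 b0 m0. assert (M : 0 < INR m) by (apply lt_0_INR; lia).
  assert (h0 : 0 <= (1 / INR m) ^ 4) by (apply pow_le; left; apply Rdiv_lt_0_compat; lra).
  destruct (negative_rooted_poch _ b 2 m b0 ltac:(lra)
    (negative_rooted_poch _ a 1 m a0 ltac:(lra) (negative_rooted_binomial m _ h0)))
    as [l l0 Hl].
  exists l; [exact l0|]. intros x. generalize (Hl x). apply is_pseries_ext. intros n.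
  rewrite Rmult_1_l. replace (2 * INR n) with (INR (2 * n)) by (rewrite mult_INR; simpl; ring).
  rewrite (poch_shift_ratio a n m), (poch_shift_ratio b (2 * n) m) by assumption.
  (* the equation lives in R seen as a normed module, where field does not apply *)
  match goal with |- ?u = ?v => change (@eq R u v) end.
  unfold approx_coef, hyp_coef.
  replace ((- (1 / INR m) ^ 4) ^ n)
    with ((- 1 / INR m) ^ n * (1 / INR m) ^ n * (1 / INR m) ^ (2 * n)).
  2:{ rewrite pow_mult, <- !Rpow_mult_distr. f_equal. field. lra. }
  field. repeat split; first [now apply Rgt_not_eq, poch_pos | apply INR_fact_neq_0 | lra].
Qed.

(** The bounds on the two growing products need n <= m, since they use that the
    added index is at most m or 2 m; for n > m the coefficient is zero. *)
Lemma approx_coef_bound (a b : R) (m n : nat) : 0 < a -> 0 < b -> (0 < m)%nat ->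
  Rabs (approx_coef a b m n) <= ((a + 2) * (b + 3) ^ 2) ^ n * hyp_coef a b n.
Proof.
  intros a0 b0 m0. unfold approx_coef.
  assert (P := hyp_coef_pos a b n a0 b0).
  rewrite Rabs_mult, (Rabs_pos_eq (hyp_coef a b n)) by lra.
  apply Rmult_le_compat_r; [lra|].
  rewrite Rpow_mult_distr, <- pow_mult.
  assert (KA : 0 < (a + 2) ^ n) by (apply pow_lt; lra).
  assert (KB : 0 < (b + 3) ^ (2 * n)) by (apply pow_lt; lra).
  destruct (le_lt_dec n m) as [nm|mn].
  - assert (A := poch_scaled_bound a 1 m n a0 m0 ltac:(lia)).
    assert (B := poch_scaled_bound b 2 m (2 * n) b0 m0 ltac:(lia)).
    replace (a + 1 + INR 1) with (a + 2) in A by (simpl; ring).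
    replace (b + 1 + INR 2) with (b + 3) in B by (simpl; ring).
    assert (N := poch_neg_scaled_bound m n m0).
    rewrite (Rabs_mult (_ * _)), (Rabs_mult (_ * _)).
    rewrite (Rabs_pos_eq (poch (a + _) _ * _)), (Rabs_pos_eq (poch (b + _) _ * _)) by lra.
    apply Rmult_le_compat; try lra.
    + apply Rmult_le_pos; [apply Rabs_pos | lra].
    + rewrite <- (Rmult_1_l ((a + 2) ^ n)). apply Rmult_le_compat; try lra. apply Rabs_pos.
  - rewrite poch_neg_nat by exact mn. rewrite !Rmult_0_l, Rabs_R0. nra.
Qed.

Lemma approx_coef_lim (a b : R) (n : nat) :
  is_lim_seq (fun M => approx_coef a b (S M) n) (hyp_coef a b n).
Proof.
  unfold approx_coef.
  assert (E : (-1 * -1) ^ n * (1 * 1) ^ n * (1 * 1) ^ (2 * n) * hyp_coef a b n = hyp_coef a b n).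
  { replace (-1 * -1) with 1 by ring. rewrite !Rmult_1_l, !pow1. ring. }
  refine (eq_ind _ (fun r : R => is_lim_seq _ r) _ _ E). clear E.
  apply is_lim_seq_mult'; [|apply is_lim_seq_const].
  apply is_lim_seq_mult'; [apply is_lim_seq_mult'|].
  - apply (is_lim_seq_ext (fun M => poch (0 + -1 * INR (S M)) n * (-1 / INR (S M)) ^ n)).
    { intros M. do 2 f_equal. ring. }
    apply poch_scaled_lim.
  - apply (is_lim_seq_ext (fun M => poch (a + 1 * INR (S M)) n * (1 / INR (S M)) ^ n)).
    { intros M. do 3 f_equal. ring. }
    apply poch_scaled_lim.
  - apply (is_lim_seq_ext (fun M => poch (b + 1 * INR (S M)) (2 * n) * (1 / INR (S M)) ^ (2 * n))).
    { intros M. do 3 f_equal. ring. }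
    apply poch_scaled_lim.
Qed.

Lemma hyp_laguerre (a b x : R) : 0 < a -> 0 < b -> laguerre_ineq (hyp_coef a b) x.
Proof.
  intros a0 b0.
  apply laguerre_ineq_lim with (c := fun M => approx_coef a b (S M))
    (u := fun n => ((a + 2) * (b + 3) ^ 2) ^ n * hyp_coef a b n).
  - apply CV_radius_hyp_coef; [lra | lra |]. apply Rmult_lt_0_compat; [lra | apply pow_lt; lra].
  - intros M n. apply approx_coef_bound; [lra | lra | lia].
  - apply approx_coef_lim.
  - intros M. apply negative_rooted_laguerre, negative_rooted_approx; [lra | lra | lia].
Qed.

Lemma CV_radius_hyp_coef_1 (a b : R) : 0 < a -> 0 < b -> CV_radius (hyp_coef a b) = p_infty.
Proof.
  intros a0 b0. rewrite <- (CV_radius_hyp_coef a b 1 a0 b0 Rlt_0_1).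
  apply CV_radius_ext. intros n. rewrite pow1. ring.
Qed.

(** The gap F'(0)^2 - F''(0) is e^2 - e d, where e = 1 / (a b (b + 1)) and
    d = 1 / ((a + 1) (b + 2) (b + 3)) < e.  With F'(x) = 0 and F(x) <> 0 the
    Laguerre inequality has a positive left side, and its right side is a square
    times - F(x) F''(x). *)
Lemma hyp_sign_change (a b x : R) : 0 < a -> 0 < b ->
  let F := PSeries (hyp_coef a b) in
  F x <> 0 -> Derive F x = 0 -> F x * Derive_n F 2 x < 0.
Proof.
  intros a0 b0 F F0 F1. assert (L := hyp_laguerre a b x a0 b0).
  assert (HR := CV_radius_hyp_coef_1 a b a0 b0).
  assert (D1 : forall y, Derive F y = PSeries (PS_derive (hyp_coef a b)) y).
  { intros y. apply Derive_PSeries. now rewrite HR. }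
  assert (D2 : Derive_n F 2 x = PSeries (PS_derive (PS_derive (hyp_coef a b))) x).
  { change (Derive_n F 2 x) with (Derive (Derive F) x). rewrite (Derive_ext _ _ x D1).
    apply Derive_PSeries. now rewrite CV_radius_derive, HR. }
  unfold laguerre_ineq in L. rewrite <- (D1 x), F1, <- D2, !PSeries_0 in L. fold (F x) in L.
  set (e1 := PS_derive (hyp_coef a b) 0) in L.
  set (e2 := PS_derive (PS_derive (hyp_coef a b)) 0) in L.
  assert (T : 0 < e1 ^ 2 - e2).
  { assert (E1 : e1 = / (a * b * (b + 1))).
    { unfold e1, PS_derive, hyp_coef. simpl. field. lra. }
    assert (E2 : e2 = / (a * b * (b + 1)) * / ((a + 1) * (b + 2) * (b + 3))).
    { unfold e2, PS_derive, hyp_coef. simpl. field. lra. }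
    assert (I : / ((a + 1) * (b + 2) * (b + 3)) < / (a * b * (b + 1))).
    { apply Rinv_lt_contravar; [|apply Rmult_le_0_lt_compat; nra].
      repeat apply Rmult_lt_0_compat; lra. }
    assert (0 < e1) by (rewrite E1; apply Rinv_0_lt_compat; repeat apply Rmult_lt_0_compat; lra).
    rewrite <- E1 in I. rewrite E2, <- E1. nra. }
  assert (0 < F x ^ 2) by now apply pow2_gt_0.
  assert (LHS := Rmult_lt_0_compat _ _ H T).
  pose proof (pow2_ge_0 (1 + e1 * Rabs x)). nra.
Qed.

(** * Derivatives of the Gamma series and Fourier critical points *)

Lemma Gamma_add_nat (x : R) (n : nat) : 0 < x -> Gamma (x + INR n) = Gamma x * poch x n.
Proof.
  intros x0. induction n as [|n IH].
  - simpl. now rewrite Rplus_0_r, Rmult_1_r.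
  - rewrite S_INR, <- Rplus_assoc, Gamma_succ by (pose proof (pos_INR n); lra).
    rewrite IH. simpl. ring.
Qed.

Definition gamma_coef (a b : R) (n : nat) : R :=
  1 / (Gamma (a + INR n) * Gamma (b + 2 * INR n)) / INR (fact n).

Lemma gamma_coef_hyp_coef (a b : R) (n : nat) : 0 < a -> 0 < b ->
  gamma_coef a b n = / (Gamma a * Gamma b) * hyp_coef a b n.
Proof.
  intros a0 b0. unfold gamma_coef, hyp_coef.
  replace (2 * INR n) with (INR (2 * n)) by (rewrite mult_INR; simpl; ring).
  rewrite !Gamma_add_nat by assumption.
  pose proof (proj2 (is_RInt_gen_Gamma a a0)). pose proof (proj2 (is_RInt_gen_Gamma b b0)).
  pose proof (poch_pos a n a0). pose proof (poch_pos b (2 * n) b0). pose proof (INR_fact_neq_0 n).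
  field. repeat split; lra.
Qed.

Lemma CV_radius_gamma_coef (a b : R) : 0 < a -> 0 < b -> CV_radius (gamma_coef a b) = p_infty.
Proof.
  intros a0 b0.
  rewrite (CV_radius_ext _ _ (fun n => gamma_coef_hyp_coef a b n a0 b0)).
  rewrite <- (CV_radius_hyp_coef_1 a b a0 b0). apply (CV_radius_scal (/ (Gamma a * Gamma b)) (hyp_coef a b)).
  pose proof (proj2 (is_RInt_gen_Gamma a a0)). pose proof (proj2 (is_RInt_gen_Gamma b b0)).
  apply Rinv_neq_0_compat. nra.
Qed.

(** An infinite real radius of convergence gives absolute convergence at
    |z|, hence convergence at the complex number z. *)
Lemma real_entire_PSeries (a : nat -> R) : CV_radius a = p_infty -> real_entire (PSeries a).
Proof.
  intros Ha. exists a. split.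
  - intros z. apply (ex_series_le (V := C_CompleteNormedModule) _ (fun n => Rabs (a n) * Rabs (Cmod z) ^ n)).
    + intros n. apply Rle_trans with (1 := norm_scal _ _).
      change (Cmod (pow_n (K := C_Ring) z n) * Cmod (RtoC (a n)) <= Rabs (a n) * Rabs (Cmod z) ^ n).
      rewrite Cmod_R, (Rabs_pos_eq (Cmod z)) by apply Cmod_ge_0. rewrite Rmult_comm.
      apply Rmult_le_compat_l; [apply Rabs_pos|]. right.
      induction n as [|n IH]; simpl; [apply Cmod_1|].
      rewrite <- IH. apply Cmod_mult.
    + now apply ex_series_pseries_abs.
  - intros x. apply PSeries_correct, CV_radius_inside. now rewrite Ha.
Qed.

(** Differentiation shifts the index, and the factorial it produces cancels
    against 1/n!, so the family is closed under it exactly, without a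
    constant. *)
Lemma Derive_n_PSeries_gamma_coef (a b x : R) (l : nat) : 0 < a -> 0 < b ->
  Derive_n (PSeries (gamma_coef a b)) l x =
  PSeries (gamma_coef (a + INR l) (b + 2 * INR l)) x.
Proof.
  intros a0 b0. rewrite Derive_n_PSeries by now rewrite CV_radius_gamma_coef.
  apply PSeries_ext. intros n. unfold PS_derive_n, gamma_coef. rewrite plus_INR.
  replace (a + INR l + INR n) with (a + (INR n + INR l)) by ring.
  replace (b + 2 * INR l + 2 * INR n) with (b + 2 * (INR n + INR l)) by ring.
  assert (P := pos_INR n). assert (Q := pos_INR l).
  pose proof (proj2 (is_RInt_gen_Gamma (a + (INR n + INR l)) ltac:(lra))).
  pose proof (proj2 (is_RInt_gen_Gamma (b + 2 * (INR n + INR l)) ltac:(lra))).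
  pose proof (INR_fact_neq_0 n). pose proof (INR_fact_neq_0 (n + l)).
  field. repeat split; lra.
Qed.

Lemma gamma_sign_change (a b x : R) : 0 < a -> 0 < b ->
  let F := PSeries (gamma_coef a b) in
  F x <> 0 -> Derive F x = 0 -> F x * Derive_n F 2 x < 0.
Proof.
  intros a0 b0 F. set (K := / (Gamma a * Gamma b)).
  assert (K0 : 0 < K).
  { apply Rinv_0_lt_compat, Rmult_lt_0_compat; now apply is_RInt_gen_Gamma. }
  assert (E : forall y, F y = K * PSeries (hyp_coef a b) y).
  { intros y. rewrite <- PSeries_scal. apply PSeries_ext. intros n.
    now apply gamma_coef_hyp_coef. }
  rewrite (Derive_ext _ _ x E), (Derive_n_ext _ _ 2 x E), Derive_n_scal_l, Derive_scal, E.
  intros F0 F1. assert (H := hyp_sign_change a b x a0 b0).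
  cbv zeta in H. specialize (H ltac:(intros Z; apply F0; rewrite Z; ring)).
  specialize (H ltac:(apply Rmult_eq_reg_l with K; lra)).
  assert (0 < K * K) by nra. nra.
Qed.

(** The hypothesis makes f^(l+1) nonzero at any zero of f^(l) where f^(l-1) does
    not vanish.  Such a zero is simple and falls in the branch with (m - 1) / 2 = 0
    critical zeros. *)
Lemma no_Fourier_critical_point (f : R -> R) :
  (forall l c, Derive_n f l c <> 0 -> Derive_n f (S l) c = 0 ->
     Derive_n f l c * Derive_n f (S (S l)) c < 0) ->
  forall c, ~ Fourier_critical_point f c.
Proof.
  intros H c (l & m & l1 & (m1 & Z & _) & k1). unfold critical_zeros in k1.
  destruct l as [|l]; [lia|]. replace (S l - 1)%nat with l in k1 by lia.
  destruct (Req_EM_T (Derive_n f l c) 0) as [_|N]; [lia|].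
  assert (Z0 := Z 0%nat ltac:(lia)). rewrite Nat.add_0_r in Z0.
  assert (S := H l c N Z0).
  assert (m = 1%nat) as ->.
  { destruct m as [|[|m]]; [lia | reflexivity |]. exfalso.
    assert (Z1 := Z 1%nat ltac:(lia)). rewrite Nat.add_1_r in Z1. rewrite Z1 in S. lra. }
  rewrite Nat.add_1_r in k1. simpl Nat.even in k1. cbv iota in k1.
  destruct (Rlt_dec _ _) as [P|_]; [lra|]. simpl in k1. lia.
Qed.

Lemma gamma_series_no_Fourier_critical_point (a b : R) : 0 < a -> 0 < b ->
  forall c, ~ Fourier_critical_point (PSeries (gamma_coef a b)) c.
Proof.
  intros a0 b0. apply no_Fourier_critical_point. intros l c.
  pose proof (pos_INR l). set (g := PSeries (gamma_coef (a + INR l) (b + 2 * INR l))).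
  assert (E : forall y, Derive_n (PSeries (gamma_coef a b)) l y = g y).
  { intros y. now apply Derive_n_PSeries_gamma_coef. }
  change (Derive_n (PSeries (gamma_coef a b)) (S l) c)
    with (Derive (Derive_n (PSeries (gamma_coef a b)) l) c).
  change (Derive_n (PSeries (gamma_coef a b)) (S (S l)) c)
    with (Derive_n (Derive_n (PSeries (gamma_coef a b)) l) 2 c).
  rewrite (Derive_ext _ _ c E), (Derive_n_ext _ _ 2 c E), E.
  apply gamma_sign_change; lra.
Qed.

Theorem theorem3 (nu : R) (hnu : -1 < nu) :
  (real_entire (lambda_Phi nu) /\ real_entire (lambda_Pi nu)) /\
  (forall c : R, ~ Fourier_critical_point (lambda_Phi nu) c) /\
  (forall c : R, ~ Fourier_critical_point (lambda_Pi nu) c).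
Proof.
  assert (EPhi : lambda_Phi nu = PSeries (gamma_coef (nu + 1) (nu + 2))).
  { apply functional_extensionality. intros x. apply PSeries_ext. intros n. unfold gamma_coef.
    do 3 f_equal; f_equal; ring. }
  assert (EPi : lambda_Pi nu = PSeries (gamma_coef (nu + 1) (nu + 1))).
  { apply functional_extensionality. intros x. apply PSeries_ext. intros n. unfold gamma_coef.
    do 3 f_equal; f_equal; ring. }
  rewrite EPhi, EPi. repeat split.
  - apply real_entire_PSeries, CV_radius_gamma_coef; lra.
  - apply real_entire_PSeries, CV_radius_gamma_coef; lra.
  - apply gamma_series_no_Fourier_critical_point; lra.
  - apply gamma_series_no_Fourier_critical_point; lra.
Qed.
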